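(* Let $p$ be a prime, let $G=\mathbb{Z}_p^2\rtimes\mathbb{Z}_p$ be the non-abelian semidirect product of order $p^3$, and let $Q$ be a quandle of size $p^3$. The following are equivalent: (i) $Q$ is connected and non-faithful, with $|Z(\mathrm{Dis}(Q))|=p$. (ii) $Q\cong\mathcal{Q}_{\mathrm{Hom}}(G,f)$ for some $f\in\mathrm{Aut}(G)$ such that $\mathrm{Fix}(f)=Z(G)$ and $\mathrm{Fix}(f_{\gamma_1(G)})=1$.
   Context: A quandle is a set $Q$ with a binary operation $*$ such that every left multiplication $L_a:b\mapsto a*b$ is a bijection of $Q$, $a*(b*c)=(a*b)*(a*c)$, and $a*a=a$ for all $a,b,c\in Q$. $\mathrm{LMlt}(Q)$ is the group generated by all $L_a$, and the displacement group $\mathrm{Dis}(Q)$ is the group generated by all $L_aL_b^{-1}$ with $a,b\in Q$. $Q$ is connected if $\mathrm{LMlt}(Q)$ is transitive on $Q$, and faithful if $a\mapsto L_a$ is injective. For a group $G$ and $f\in\mathrm{Aut}(G)$, $\mathrm{Fix}(f)=\{g\in G: f(g)=g\}$, and $\mathcal{Q}_{\mathrm{Hom}}(G,f)$ is the quandle on the set $G$ with operation $a*b=a f(a^{-1}b)$. $Z(\cdot)$ denotes the center of a group, and $\gamma_1(G)=[G,G]$ is the derived subgroup; $f_{\gamma_1(G)}$ is the automorphism of $G/\gamma_1(G)$ induced by $f$, that is, $a\gamma_1(G)\mapsto f(a)\gamma_1(G)$.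
   Formalization: The formal theorem assumes p is odd; for p = 2 the claim is false, since Q_Hom(Q_8, f) with f the order-3 automorphism of the quaternion group satisfies (i), while no automorphism of the non-abelian Z_2^2 ⋊ Z_2 (the dihedral group of order 8) satisfies (ii). *)

(* Defs.v *)
From mathcomp Require Import all_boot all_algebra all_fingroup all_solvable.

Set Implicit Arguments.
Unset Strict Implicit.
Unset Printing Implicit Defensive.

Import GroupScope.

Record finQuandle := FinQuandle {
  qcarrier :> finType;
  qop : qcarrier -> qcarrier -> qcarrier;
  qop_bij : forall a, bijective (qop a);
  qop_distl : forall a b c, qop a (qop b c) = qop (qop a b) (qop a c);
  qop_idem : forall a, qop a a = a
}.

Definition quandle_isom (Q Q' : finQuandle) : Prop :=
  exists2 h : Q -> Q', bijective h & forall a b, h (qop a b) = qop (h a) (h b).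

Section QuandleGroups.

Variable Q : finQuandle.

Definition qL (a : Q) : {perm Q} := perm (bij_inj (qop_bij a)).

Definition LMlt : {group {perm Q}} := [group of <<[set qL a | a : Q]>>].

(* Products in {perm Q} compose from left to right, (s * t) x = t (s x), so the
   composite "L_a after L_b^-1" is written (qL b)^-1 * qL a. *)
Definition Dis : {group {perm Q}} :=
  [group of <<[set (qL b)^-1 * qL a | a : Q, b : Q]>>].

Definition qconnected : bool := [transitive LMlt, on [set: Q] | 'P].

Definition qfaithful : Prop := injective qL.

End QuandleGroups.

Section PrincipalQuandle.

Variables (G : finGroupType) (f : {perm G}).

Definition Fix : {set G} := [set g | f g == g].

(* Every coset of the derived subgroup is of the form a * gamma_1, a its
   representative; independence of the representative is induced_der1E. *)
Definition induced_der1 (x : coset_of [set: G]^`(1)) : coset_of [set: G]^`(1) :=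
  coset [set: G]^`(1) (f (repr x)).

Definition Fix_der1 : {set coset_of [set: G]^`(1)} :=
  [set x | induced_der1 x == x].

Hypothesis Af : f \in Aut [set: G].

Lemma AutT_morph a b : f (a * b) = f a * f b.
Proof. by have /morphicP := Aut_morphic Af; apply; rewrite inE. Qed.

Lemma AutT_morphV a : f a^-1 = (f a)^-1.
Proof. by rewrite -(autmE Af) morphV ?inE. Qed.

Lemma induced_der1E a :
  induced_der1 (coset [set: G]^`(1) a) = coset [set: G]^`(1) (f a).
Proof.
have NT x : x \in 'N([set: G]^`(1)).
  by apply: (subsetP (der_norm 1 [set: G])); rewrite inE.
rewrite /induced_der1.
have : repr (coset [set: G]^`(1) a) \in [set: G]^`(1) :* a.
  by rewrite -val_coset // mem_repr_coset.
case/rcosetP=> d Dd ->.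
have fTE : autm Af @* [set: G]^`(1) = [set: G]^`(1).
  by rewrite morphim_der // im_autm.
have Dfd : f d \in [set: G]^`(1).
  have: autm Af d \in autm Af @* [set: G]^`(1) by rewrite mem_morphim ?inE.
  by rewrite fTE autmE.
by rewrite AutT_morph morphM //= (coset_id Dfd) mul1g.
Qed.

Definition qhom_op (a b : G) : G := a * f (a^-1 * b).

Lemma qhom_bij a : bijective (qhom_op a).
Proof.
apply: injF_bij => b c; rewrite /qhom_op => /mulgI/perm_inj; exact: mulgI.
Qed.

Lemma qhom_distl a b c :
  qhom_op a (qhom_op b c) = qhom_op (qhom_op a b) (qhom_op a c).
Proof.
rewrite /qhom_op.
by rewrite invMg -!mulgA mulKg !(AutT_morph, AutT_morphV, invMg, invgK, mulgA) !(mulgKV, mulgK).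
Qed.

Lemma qhom_idem a : qhom_op a a = a.
Proof. by rewrite /qhom_op mulVg -(autmE Af) morph1 mulg1. Qed.

Definition QHom : finQuandle := FinQuandle qhom_bij qhom_distl qhom_idem.

End PrincipalQuandle.

(* For prime p there is exactly one such group up to isomorphism. *)
Definition nonabelian_Zp2_sdprod_Zp (p : nat) (G : finGroupType) : Prop :=
  [/\ #|G| = (p ^ 3)%N, ~~ abelian [set: G] &
      exists K H : {group G},
        [/\ K \isog [set: 'Z_p * 'Z_p], H \isog [set: 'Z_p]
          & K ><| H = [set: G]]].

(* Main.v *)
Require Import Defs.
From mathcomp Require Import all_boot all_order all_algebra all_fingroup all_solvable.
From mathcomp Require Import all_field all_character.

Set Implicit Arguments.
Unset Strict Implicit.
Unset Printing Implicit Defensive.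

Import GroupScope.

(* The key is a theorem of Kazarin's type: if a conjugacy class of p-power size
   generates a finite group G, then G' is a p-group.  Suppose y in G' has prime
   order q <> p.  After dividing by 'O_p(G), p does not divide |G : G'|.  A
   nonlinear irreducible character of degree prime to p vanishes on the class
   (Burnside).  Let w_chi be the norm to Q of the central character omega_chi
   on the class: w_chi is an integer, an eigenvalue of a product of class sums.
   Counting the words of length N in these classes with product conjugate to y,
   up to rotation, shows that sum_chi chi(1) chi(y)^* w_chi^N tends q-adically
   to 0 as N runs through suitable multiples of q^a, so the sum of
   chi(1) chi(y)^* over the chi with w_chi prime to q is 0.  Modulo p only the
   linear characters contribute to it, and they contribute |G : G'|.

   Hence D = Dis(Q) is a p-group for a connected Q of p-power size.  With
   c = L_e one has [D, c] = D, so c has no fixed points on D/D' and C_D(c) lies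
   in D'.  If Q is not faithful then |D : C_D(c)| <= p^2, while D nonabelian
   gives |D : D'| >= p^2; so C_D(c) = D', and the three subgroups lemma makes D'
   central.  Therefore |D| = p^3, D is regular on Q, and since x |-> x^p is a
   c-equivariant homomorphism into the fixed points of c, D has exponent p.
   Conversely Dis(Q_Hom(G, f)) consists of the translations by
   <x f(x)^-1 : x in G>, which is all of G because it is so modulo G', hence
   modulo the Frattini subgroup. *)

(** * Words in conjugacy classes *)

(** With [u] the first [l] letters and [r] the rest, invariance reads [r ++ u = u ++ r], so a
    nonempty [r] starts with [u] and is again periodic. *)
Lemma prod_rot_periodic (gT : finGroupType) (l e : nat) (s : seq gT) :
    size s = (l * e)%N -> seq.rot l s = s ->
  \prod_(x <- s) x = (\prod_(x <- take l s) x) ^+ e.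
Proof.
elim: e s => [|e IHe] s; first by rewrite muln0 => /size0nil->; rewrite big_nil.
rewrite mulnS => sz_s rot_s.
have sz_u: size (take l s) = l by rewrite size_takel // sz_s leq_addr.
have sz_r: size (drop l s) = (l * e)%N by rewrite size_drop sz_s addKn.
rewrite -{1}(cat_take_drop l s) big_cat expgS; congr (_ * _).
case: e => [|e] in IHe sz_s sz_r *.
  by move: sz_r; rewrite muln0 => /size0nil->; rewrite big_nil.
have cat_ru: drop l s ++ take l s = take l s ++ drop l s.
  by rewrite cat_take_drop.
have take_r: take l (drop l s) = take l s.
  have := congr1 (take l) cat_ru; rewrite (take_size_cat _ sz_u).
  by rewrite takel_cat // sz_r mulnS leq_addr.
rewrite (IHe (drop l s)) ?take_r //.
have rE: drop l s = take l s ++ drop l (drop l s).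
  by rewrite -[LHS](cat_take_drop l) take_r.
have := congr1 (drop l) cat_ru.
rewrite {1}rE -catA !drop_size_cat // /seq.rot take_r => {2}<-.
by rewrite drop_drop.
Qed.

Lemma dvdn_card_porbits (T : finType) (s : {perm T}) (A : {set T}) d :
    (forall x, x \in A -> s x \in A) ->
    (forall x, x \in A -> d %| #|porbit s x|) ->
  d %| #|A|.
Proof.
move=> sA dvd; have actA: [acts <[s]>, on A | 'P].
  rewrite cycle_subG; apply/astabsP.
  have sAA: s @: A \subset A by apply/subsetP=> _ /imsetP[x /sA ? ->].
  have eqA: s @: A = A.
    by apply/eqP; rewrite eqEcard sAA (card_imset _ (@perm_inj _ s)) /=.
  by move=> x; rewrite /= apermE -{1}eqA (mem_imset _ _ (@perm_inj _ s)).
rewrite -(acts_sum_card_orbit actA); apply: dvdn_sum => _ /imsetP[x Ax ->].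
by have := dvd x Ax; rewrite porbit.unlock.
Qed.

Lemma porbit_dvdn (T : finType) (s : {perm T}) N x :
  (forall y, iter N s y = y) -> #|porbit s x| %| N.
Proof.
move=> sN; have os: #[s] %| N.
  by rewrite order_dvdn; apply/eqP/permP=> y; rewrite permX sN perm1.
apply: dvdn_trans os; rewrite porbit.unlock -/(orbit 'P <[s]> x) card_orbit.
exact: dvdn_indexg.
Qed.

(* Rotating the words by [m] letters preserves [A]; an orbit of length [d]
   consists of words with period [m * d], whose product is an [N / d]-th power,
   so orbits of length prime to a high power of [q] are excluded. *)
Lemma dvdn_card_words (gT : finGroupType) (q a j m N : nat)
    (A : {set (m * N).-tuple gT}) :
    prime q -> 0 < N -> q ^ a %| N ->
    (forall t, t \in A -> [tuple of seq.rot m t] \in A) ->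
    (forall (t : (m * N).-tuple gT) g,
       t \in A -> \prod_(x <- t) x != g ^+ (q ^ j)) ->
  q ^ (a - j) %| #|A|.
Proof.
move=> pr_q N_gt0 qN rotA notpow.
have rinj: injective (fun t : (m * N).-tuple gT => [tuple of seq.rot m t]).
  by move=> t u /(congr1 val) /= /rot_inj; apply: val_inj.
pose s := perm rinj.
have iterE k (t : (m * N).-tuple gT) : k <= N ->
    iter k s t = seq.rot (m * k) t :> seq gT.
  elim: k => [|k IHk] le_k; first by rewrite muln0 rot0.
  rewrite /= permE /= IHk ?(ltnW le_k) // mulnS rotD //.
  by rewrite size_tuple -mulnS leq_mul2l le_k orbT.
apply: (@dvdn_card_porbits _ s) => t At; first by rewrite permE rotA.
have dN: #|porbit s t| %| N.
  apply: porbit_dvdn => y; apply/val_inj.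
  by rewrite /= iterE // rot_oversize // size_tuple.
have d_gt0: 0 < #|porbit s t| by rewrite lt0n card_porbit_neq0.
have rot_t: seq.rot (m * #|porbit s t|) t = t.
  by rewrite -(iterE _ t (dvdn_leq N_gt0 dN)) iter_porbit.
case/dvdnP: (dN) => e defN.
have e_gt0: 0 < e by move: N_gt0; rewrite defN muln_gt0 => /andP[].
have eltj: logn q e < j.
  rewrite ltnNge; apply/negP => le_j.
  have /dvdnP[f def_e]: q ^ j %| e.
    by rewrite pfactor_dvdn.
  have szt: size t = (m * #|porbit s t| * e)%N.
    by rewrite size_tuple [in LHS]defN mulnAC mulnA.
  have := notpow t ((\prod_(x <- take (m * #|porbit s t|) t) x) ^+ f) At.
  by rewrite (prod_rot_periodic szt rot_t) def_e expgM eqxx.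
(* The [q]-valuation of the orbit length is that of [N] minus that of [e], hence at least
   [a - j]. *)
apply: dvdn_trans (_ : q ^ logn q #|porbit s t| %| _); last exact: pfactor_dvdnn.
apply: dvdn_exp2l; have: q ^ a %| e * #|porbit s t| by rewrite -defN.
rewrite pfactor_dvdn ?muln_gt0 ?e_gt0 // lognM //.
by rewrite leq_subLR => /leq_trans-> //; rewrite leq_add2r ltnW.
Qed.

(** * Conjugacy classes of prime power size *)

Section CharacterTheory.

Import Order.TTheory GRing.Theory Num.Theory.
Local Open Scope ring_scope.

(** On [<[x]>] a character is a sum of linear ones, whose values are roots of unity that [u] raises
    to the power [k]. *)
Lemma char_aut_expg (gT : finGroupType) (G : {group gT}) (k : nat)
    (u : {rmorphism algC -> algC}) (chi : 'CF(G)) x :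
    (forall z, z ^+ #|G| = 1 -> u z = z ^+ k) ->
    chi \is a character -> x \in G ->
  u (chi x) = chi (x ^+ k)%g.
Proof.
move=> uE Nchi Gx; have sXG: <[x]>%g \subset G by rewrite cycle_subG.
have Nres: 'Res[<[x]>] chi \is a character by rewrite cfRes_char.
have -> : chi x = 'Res[<[x]>] chi x by rewrite cfResE ?cycle_id.
have -> : chi (x ^+ k)%g = 'Res[<[x]>] chi (x ^+ k)%g.
  by rewrite cfResE ?mem_cycle.
have [r ->] := char_sum_irr Nres; rewrite !sum_cfunE rmorph_sum.
apply: eq_bigr => i _; have /char_abelianP linX := cycle_abelian x.
rewrite (lin_charX (linX i)) ?cycle_id // uE //.
have /dvdnP[m ->] := order_dvdG Gx.
by rewrite mulnC exprM lin_char_unity_root ?expr1n ?cycle_id.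
Qed.

(** The [u i] extend to [algC] the Galois automorphisms of a number field containing the character
    values of [G]; the last clause is the rationality of the norm. *)
Lemma character_field_norm (gT : finGroupType) (G : {group gT}) :
  exists (I : finType) (r : seq I) (u : I -> {rmorphism algC -> algC})
         (k : I -> nat),
  [/\ r != [::], forall i, coprime (k i) #|G|,
      forall i (chi : 'CF(G)) x, chi \is a character -> x \in G ->
        u i (chi x) = chi (x ^+ k i)%g
    & forall (c : Iirr G -> algC) x, (forall j, c j \in Crat) -> x \in G ->
        \prod_(i <- r) u i (\sum_j c j * 'chi_j x) \in Crat].
Proof.
have [Qn galQn [QnC gQnC [w [prim_w _] Qn_g]]] := group_num_field_exists G.
have prim_z: #|G|.-primitive_root (QnC w) by rewrite fmorph_primitive_root.
have /all_sig[k kP] (nu : gal_of {:Qn}) :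
  {k | sval (gQnC nu) (QnC w) = QnC w ^+ k}.
  apply: sig_eqW.
  have [|k ->] := prim_rootP prim_z (x := sval (gQnC nu) (QnC w)); last by exists (k : nat).
  by rewrite -rmorphXn (prim_expr_order prim_z) rmorph1.
have uE nu z : z ^+ #|G| = 1 -> sval (gQnC nu) z = z ^+ k nu.
  case/(prim_rootP prim_z) => i ->.
  by rewrite rmorphXn kP -!exprM mulnC.
exists (gal_of {:Qn}), (enum ('Gal({:Qn} / 1))%g),
  (fun nu => sval (gQnC nu)), k; split.
- by rewrite -size_eq0 -cardE -lt0n cardG_gt0.
- move=> nu; rewrite -(prim_root_exp_coprime _ prim_z) -kP.
  by rewrite fmorph_primitive_root.
- by move=> nu chi x Nchi Gx; apply: char_aut_expg => // z /uE.
move=> c x Qc Gx.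
have [a Da]: exists a, QnC a = \sum_j c j * 'chi_j x.
  have /fin_all_exists[b Db] j: exists b, QnC b = c j * 'chi_j x.
    have [b <-] := Qn_g _ G _ (irr_char j) x (order_dvdG Gx).
    have /CratP[d ->] := Qc j.
    by exists (ratr d * b); rewrite rmorphM fmorph_rat.
  by exists (\sum_j b j); rewrite rmorph_sum; apply: eq_bigr.
rewrite -Da big_enum /=.
have -> : \prod_(nu in 'Gal({:Qn} / 1)) sval (gQnC nu) (QnC a)
          = QnC (galNorm 1 {:Qn} a).
  rewrite rmorph_prod; apply: eq_bigr => nu _.
  by case: (gQnC nu) => f /= ->.
have /vlineP[/= d ->] := mem_galNorm galQn (memvf a).
by rewrite alg_num_field fmorph_rat rpred_rat.
Qed.

(** By Schur's lemma the class sum acts as a scalar; multiply by the matrix of [z] and take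
    traces. *)
Lemma irr_class_mul (gT : finGroupType) (G : {group gT}) (i : Iirr G) x z :
    x \in G -> z \in G ->
  \sum_(y in x ^: G) 'chi_i (y * z)%g
    = (#|x ^: G|%:R * 'chi_i x / 'chi_i 1%g) * 'chi_i z.
Proof.
move=> Gx Gz.
pose k := enum_rank_in (mem_classes Gx) (x ^: G).
have ek: enum_val k = x ^: G by rewrite enum_rankK_in // mem_classes.
have k_x: x \in enum_val k by rewrite ek class_refl.
rewrite -(gring_mode_class_sum_eq i k_x).
have cK: gring_op 'Chi_i 'K_k = ('omega_i['K_k])%:M.
  by rewrite irr_gring_center // gring_class_sum_central.
have chiE y : y \in G -> 'chi_i y = \tr ('Chi_i y).
  by move=> Gy; rewrite -{1}irrRepr cfunE Gy.
have sxG: {subset x ^: G <= G} by apply/subsetP; rewrite class_subG.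
transitivity (\tr (gring_op 'Chi_i 'K_k *m 'Chi_i z)).
  rewrite /gring_class_sum ek /gset_mx linear_sum mulmx_suml linear_sum.
  apply: eq_bigr => y /sxG Gy; rewrite /= gring_opG // -repr_mxM // chiE //.
  by rewrite groupM.
by rewrite cK mul_scalar_mx mxtraceZ chiE.
Qed.

(** * Counting class words with characters *)

Definition class_word (gT : finGroupType) (G : {set gT}) (cs w : seq gT) : bool :=
  all2 (fun x c => x \in c ^: G) w cs.

Lemma class_word_cat (gT : finGroupType) (G : {set gT}) (cs1 cs2 w1 w2 : seq gT) :
    size w1 = size cs1 ->
  class_word G (cs1 ++ cs2) (w1 ++ w2) = class_word G cs1 w1 && class_word G cs2 w2.
Proof.
elim: cs1 w1 => [|c cs1 IH] [|x w1] //= [sz].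
by rewrite /class_word /= -andbA -/(class_word G _ _) IH.
Qed.

Lemma class_word_prod (gT : finGroupType) (G : {group gT}) (cs w : seq gT) :
  {subset cs <= G} -> class_word G cs w -> (\prod_(x <- w) x)%g \in G.
Proof.
elim: cs w => [|c cs IH] [|x w] //= sG; rewrite ?big_nil ?group1 // big_cons.
rewrite /class_word /= => /andP[xc wc]; rewrite groupM ?(IH w) //.
  by apply: subsetP xc; rewrite class_subG ?sG ?mem_head.
by move=> y cy; apply: sG; rewrite inE cy orbT.
Qed.

(** Induction on [cs]: the free factor [z] absorbs the product of the later letters, so
    [irr_class_mul] handles the first one. *)
Lemma irr_class_word (gT : finGroupType) (G : {group gT}) (i : Iirr G)
    (cs : seq gT) n z :
    size cs = n -> {subset cs <= G} -> z \in G ->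
  \sum_(w : n.-tuple gT | class_word G cs w) 'chi_i (\prod_(x <- w) x * z)%g
    = \prod_(c <- cs) (#|c ^: G|%:R * 'chi_i c / 'chi_i 1%g) * 'chi_i z.
Proof.
move=> <- {n}; elim: cs z => [|c cs IH] z sG Gz /=.
  rewrite big_nil mul1r (big_pred1 [tuple]); first by rewrite big_nil mul1g.
  by move=> t; rewrite /= [t]tuple0 /class_word /= eqxx.
have Gc: c \in G by rewrite sG ?mem_head.
have sG': {subset cs <= G} by move=> y cy; apply: sG; rewrite inE cy orbT.
rewrite big_cons -mulrA -IH // mulr_sumr.
rewrite (reindex (fun p : gT * (size cs).-tuple gT => [tuple of p.1 :: p.2])) /=.
  2: { exists (fun t : (size cs).+1.-tuple gT => (thead t, [tuple of behead t])).
       by move=> [x t] _; rewrite theadE; congr (_, _); apply: val_inj.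
       by move=> t _; rewrite /= -tuple_eta. }
rewrite -(pair_big_dep (fun x => x \in c ^: G)
   (fun (x : gT) (t : (size cs).-tuple gT) => class_word G cs t)
   (fun x (t : (size cs).-tuple gT) => 'chi_i (\prod_(y <- x :: t) y * z)%g)) /=.
rewrite exchange_big; apply: eq_bigr => t wt.
have Gt := class_word_prod sG' wt.
rewrite -irr_class_mul ?groupM //; apply: eq_bigr => x _.
by rewrite big_cons mulgA.
Qed.

Section RepeatedWords.

Variables (gT : finGroupType) (G : {group gT}) (cs : seq gT).
Hypothesis sG : {subset cs <= G}.

(** The product is only required to be conjugate to [y], because moving the first block to the end
    conjugates the product. *)
Definition class_words (N : nat) (y : gT) : {set (size cs * N).-tuple gT} :=
  [set w : (size cs * N).-tuple gT |
     class_word G (flatten (nseq N cs)) w & (\prod_(x <- w) x)%g \in y ^: G].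

Lemma flatten_nseq_sub N : {subset flatten (nseq N cs) <= G}.
Proof. by move=> x /flattenP[s /nseqP[-> _] /sG]. Qed.

Lemma size_flatten_nseq N : size (flatten (nseq N cs)) = (size cs * N)%N.
Proof. by rewrite size_flatten /shape map_nseq sumn_nseq. Qed.

Lemma rot_class_words N y (w : (size cs * N).-tuple gT) : (0 < N)%N ->
  w \in class_words N y -> [tuple of seq.rot (size cs) w] \in class_words N y.
Proof.
case: N w => // N w _; rewrite !inE => /andP[cw yw].
have sz1: size (take (size cs) w) = size cs.
  by rewrite size_takel // size_tuple mulnS leq_addr.
have sz2: size (drop (size cs) w) = size (flatten (nseq N cs)).
  by rewrite size_drop size_tuple mulnS addKn size_flatten_nseq.
move: cw yw; rewrite -{1 2}(cat_take_drop (size cs) w) /= class_word_cat //.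
case/andP=> cw1 cw2; rewrite big_cat /seq.rot big_cat /= => yw.
have -> : cs ++ flatten (nseq N cs) = flatten (nseq N cs) ++ cs.
  by elim: N {w cw1 cw2 yw sz1 sz2} => [|N IH] /=; rewrite ?cats0 // -catA -IH.
rewrite class_word_cat // cw1 cw2 /=.
have G1 := class_word_prod sG cw1.
have -> : (\prod_(x <- drop (size cs) w) x * \prod_(x <- take (size cs) w) x
  = (\prod_(x <- take (size cs) w) x * \prod_(x <- drop (size cs) w) x)
      ^ (\prod_(x <- take (size cs) w) x))%g.
  by rewrite conjgE !mulgA mulVg mul1g.
by rewrite -(class_eqP yw) memJ_class.
Qed.

(** The exponent kills the [q]-part of [g]; so no element of order divisible by [q] is such a
    power. *)
Lemma expg_not_dvdn_order (q : nat) (g : gT) :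
  prime q -> ~~ (q %| #[g ^+ (q ^ logn q #|[set: gT]|)]%g)%N.
Proof.
move=> pr_q; set z := (g ^+ _)%g.
have z1: z.`_q = 1%g.
  rewrite consttX; apply/eqP; rewrite -order_dvdn order_constt p_part.
  by rewrite dvdn_exp2l // dvdn_leq_log ?cardG_gt0 // order_dvdG ?inE.
apply/negP=> qz; have := order_constt q z; rewrite z1 order1 p_part => /eqP.
rewrite eq_sym -[1%N](expn0 q) eqn_exp2l ?prime_gt1 //.
by rewrite eqn0Ngt logn_gt0 mem_primes pr_q order_gt0 qz.
Qed.

(** The loss [logn q #|[set: gT]|] is independent of [a], so suitable [N] give divisibility by any
    power of [q]. *)
Lemma dvdn_card_class_words (q a N : nat) y :
    prime q -> (q %| #[y])%N -> (0 < N)%N -> (q ^ a %| N)%N ->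
  (q ^ (a - logn q #|[set: gT]|) %| #|class_words N y|)%N.
Proof.
move=> pr_q qy N_gt0 qN; apply: dvdn_card_words qN _ _ => //.
  by move=> t; apply: rot_class_words.
move=> t g; rewrite inE => /andP[_ /imsetP[h _ ->]]; apply/eqP=> e.
by have := expg_not_dvdn_order g pr_q; rewrite -e orderJ qy.
Qed.

Lemma card_class_words N y : y \in G ->
  #|'C_G[y]|%:R * #|class_words N y|%:R =
  \sum_(i : Iirr G)
     (\prod_(c <- cs) (#|c ^: G|%:R * 'chi_i c / 'chi_i 1%g)) ^+ N
        * 'chi_i 1%g * ('chi_i y)^* :> algC.
Proof.
move=> Gy; pose ws := flatten (nseq N cs).
transitivity (\sum_(w : (size cs * N).-tuple gT | class_word G ws w)
   \sum_i 'chi[G]_i (\prod_(x <- w) x)%g * ('chi_i y)^*).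
  under eq_bigr do rewrite second_orthogonality_relation //.
  rewrite (eq_bigr (fun w : (size cs * N).-tuple gT =>
     if (\prod_(x <- w) x)%g \in y ^: G then #|'C_G[y]|%:R else 0)).
    rewrite -big_mkcondr sumr_const mulr_natr; congr (_ *+ _).
    by apply: eq_card => w; rewrite !inE.
  move=> w _; case: ifP => [yw|_]; rewrite ?mulr0n // mulr1n; congr _%:R.
  by case/imsetP: yw => g Gg ->; rewrite cent1J -{1}(conjGid Gg) -conjIg cardJg.
rewrite exchange_big; apply: eq_bigr => i _; rewrite -mulr_suml; congr (_ * _).
transitivity (\sum_(w : (size cs * N).-tuple gT | class_word G ws w)
    'chi_i (\prod_(x <- w) x * 1)%g).
  by apply: eq_bigr => w _; rewrite mulg1.
rewrite irr_class_word ?size_flatten_nseq //; last exact: flatten_nseq_sub.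
congr (_ * _); rewrite /ws; elim: N {ws} => [|N IH]; first by rewrite big_nil.
by rewrite /= big_cat /= IH exprS.
Qed.

End RepeatedWords.

(** Both elements generate the same cyclic group, hence have the same centralizer. *)
Lemma card_class_expg (gT : finGroupType) (G : {group gT}) x k :
  x \in G -> coprime k #|G| -> #|(x ^+ k)%g ^: G| = #|x ^: G|.
Proof.
move=> Gx co_k; rewrite -!index_cent1; congr #|_ : _ :&: _|.
have : generator <[x]>%g (x ^+ k)%g.
  rewrite generator_coprime coprime_sym.
  exact: coprime_dvdr (order_dvdG Gx) co_k.
by rewrite /generator => /eqP e; rewrite -!cent_cycle -e.
Qed.

(** Since the degree is prime to the class size, otherwise [c] lies in the center of ['chi_i]. This
    center is normal, so it is all of [G]; then ['chi_i] has constant modulus, and norm 1 forces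
    degree 1. *)
Lemma irr_nonlinear_vanish (gT : finGroupType) (G : {group gT}) (p : nat)
    (i : Iirr G) c :
    prime p -> <<c ^: G>>%g = G -> p.-nat #|c ^: G| ->
    'chi_i \isn't a linear_char -> ~~ (p %| 'chi_i 1%g)%C ->
  'chi_i c = 0.
Proof.
move=> pr_p genG pcG nlin npchi.
have nat1: 'chi_i 1%g = (Num.truncn ('chi_i 1%g))%:R by rewrite truncnK ?Cnat_irr1.
apply: coprime_degree_support_cfcenter.
  rewrite nat1 dvdC_nat -prime_coprime // coprime_sym in npchi.
  have [m ->] := p_natP pcG.
  by rewrite coprimeXr.
apply/negP=> Zc; case/negP: nlin.
have sGZ: G \subset ('Z('chi_i))%CF.
  have : <<c ^: G>>%g \subset ('Z('chi_i))%CF; last by rewrite genG.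
  by rewrite gen_subG class_sub_norm // normal_norm ?cfcenter_normal.
have eqZ: ('Z('chi_i))%CF = G :> {set gT}.
  by apply/eqP; rewrite eqEsubset cfcenter_sub.
have normchi x : x \in G -> `|'chi_i x| = 'chi_i 1%g.
  by move=> Gx; apply/eqP; rewrite -irr_cfcenterE // eqZ.
have : '['chi_i]_G = 1 by apply: cfnorm_irr.
rewrite (cfnormE (cfun_onG _)) (eq_bigr (fun=> 'chi_i 1%g ^+ 2)) => [|x Gx]; last first.
  by rewrite normchi.
rewrite sumr_const -[X in _ * X]mulr_natl mulKf ?neq0CG // => /eqP.
rewrite sqrp_eq1 ?char1_ge0 ?irr_char // => /eqP chi1.
by rewrite qualifE /= irr_char chi1 eqxx.
Qed.

(** Euler's theorem for [n] prime to [q]; otherwise the exponent is at least [a]. Taking [a.+1]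
    makes the exponent a multiple of [q ^ a], as the word count demands, and the factor 2 will
    remove signs. *)
Lemma expn_totient_mod (q a n : nat) : prime q -> (0 < a)%N ->
  (n ^ (totient (q ^ a.+1) * 2) == (~~ (q %| n)%N : nat) %[mod q ^ a])%N.
Proof.
move=> pr_q a_gt0; have [qn|nqn] /= := boolP (q %| n)%N.
  rewrite mod0n; have: (q ^ a %| n ^ a)%N by rewrite dvdn_exp2r.
  move/dvdn_trans; apply; apply: dvdn_exp2l; rewrite totient_pfactor //=.
  rewrite mulnAC; apply: leq_trans (ltnW (ltn_expl a (prime_gt1 pr_q))) _.
  by rewrite leq_pmull // muln_gt0 -subn1 subn_gt0 prime_gt1.
have co: coprime n (q ^ a.+1) by rewrite coprimeXr // coprime_sym prime_coprime.
have /eqP := Euler_exp_totient co.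
rewrite eqn_mod_dvd ?expn_gt0; last by case: (n) nqn => //; rewrite dvdn0.
move=> /(dvdn_trans (dvdn_exp2l q (leqnSn a))); rewrite -eqn_mod_dvd; last first.
  by rewrite expn_gt0; case: (n) nqn => //; rewrite dvdn0.
by move=> /eqP e; rewrite expnM -modnXm e modnXm exp1n.
Qed.

Lemma Cint_expn_totient_mod (q a : nat) (w : algC) :
    prime q -> (0 < a)%N -> w \in Num.int ->
  (w ^+ (totient (q ^ a.+1) * 2)
     == (~~ (q %| Num.truncn `|w|)%N)%:R %[mod (q ^ a)%N])%A.
Proof.
move=> pr_q a_gt0 Zw; have Dn: (Num.truncn `|w|)%:R = `|w|.
  by rewrite truncnK // natr_norm_int.
rewrite mulnC exprM -intr_normK // -Dn -exprM -natrX mulnC eqAmod_nat.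
rewrite natrK; exact: expn_totient_mod.
Qed.

Lemma Cint_unbounded_dvd (q : nat) (z : algC) : (1 < q)%N -> z \in Num.int ->
  (forall b, z / (q ^ b)%:R \in Num.int) -> z = 0.
Proof.
move=> q_gt1 Zz dvd; apply/eqP/negPn/negP => nz.
have Dn: (Num.truncn `|z|)%:R = `|z| by rewrite truncnK // natr_norm_int.
(* For [n = |z|] the bound [n < q ^ n] contradicts that a nonzero integer has modulus at least 1. *)
set n := Num.truncn _ in Dn.
have := norm_intr_ge1 (dvd n); rewrite mulf_neq0 ?invr_eq0 ?pnatr_eq0 //; last first.
  by rewrite -lt0n expn_gt0 ltnW.
move=> /(_ isT); rewrite normrM normfV normr_nat -Dn ler_pdivlMr ?mul1r.
  by rewrite ler_nat leqNgt ltn_expl.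
by rewrite ltr0n expn_gt0 ltnW.
Qed.

Lemma dvdA_natE n (z : algC) : (0 < n)%N -> (n %| z)%A = (z / n%:R \in Aint).
Proof. by move=> n_gt0; rewrite [LHS]unfold_in pnatr_eq0 eqn0Ngt n_gt0. Qed.

Lemma der1_pgroup_p'index (gT : finGroupType) (G : {group gT}) (p : nat) c :
    prime p -> <<c ^: G>>%g = G -> p.-nat #|c ^: G| ->
    ~~ (p %| #|G : G^`(1)%g|)%N ->
  p.-group G^`(1)%g.
Proof.
move=> pr_p genG pcG p'iG; have Gc: c \in G.
  by have := mem_gen (class_refl G c); rewrite genG.
apply/pgroupP=> q pr_q qD; have [->|neq_qp] := eqVneq q p; first by rewrite inE.
have [y Dy oy] := Cauchy pr_q qD.
have Gy: y \in G by apply: subsetP (der_sub 1 G) _ Dy.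
have [I [r [u [k [nz_r co_k u_char u_rat]]]]] := character_field_norm G.
(* Using all the powers of [c] that arise from Galois conjugation turns the eigenvalue [W i] into a
   norm, hence a rational integer. *)
pose cs := [seq (c ^+ k i)%g | i <- r].
have csG: {subset cs <= G} by move=> _ /mapP[i _ ->]; rewrite groupX.
pose om (i : Iirr G) x := #|x ^: G|%:R * 'chi_i x / 'chi_i 1%g.
pose W i := \prod_(x <- cs) om i x.
have WE i : W i = \prod_(j <- r) u j (om i c).
  rewrite /W big_map; apply: eq_bigr => j _; rewrite /om card_class_expg //.
  by rewrite !rmorphM fmorphV !u_char ?irr_char ?expg1n ?rmorph_nat.
have ZW i : W i \in Num.int.
  rewrite WE; apply: Cint_rat_Aint; last first.
    by apply: rpred_prod => j _; rewrite Aint_aut Aint_class_div_irr1.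
  pose a (j : Iirr G) := if j == i then #|c ^: G|%:R / 'chi_i 1%g else 0.
  have sumE: \sum_j a j * 'chi_j c = om i c.
    rewrite (bigD1 i) //= big1 => [|j /negPf nji]; last by rewrite /a nji mul0r.
    by rewrite addr0 /a eqxx mulrAC.
  rewrite -sumE; apply: u_rat => // j; rewrite /a; case: eqP => _; rewrite ?rpred0 //.
  by rewrite irr1_degree rpred_div ?rpred_nat.
(* [T] is the [q]-adic limit of the sums in [card_class_words]: along the chosen [N], powers of
   [W i] tend to 1 if [B i] and to 0 otherwise. *)
pose B i := ~~ (q %| Num.truncn `|W i|)%N.
pose T := \sum_(i | B i) 'chi[G]_i 1%g * ('chi_i y)^*.
pose J := logn q #|[set: gT]|.
have dvdT b : T / (q ^ b)%:R \in Aint.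
  (* [J] pays for the loss in the word count; the successor makes [a] positive. *)
  pose a := (b + J).+1; pose N := (totient (q ^ a.+1) * 2)%N.
  have N_gt0: (0 < N)%N by rewrite muln_gt0 totient_gt0 expn_gt0 prime_gt0.
  have qN: (q ^ a %| N)%N by rewrite /N totient_pfactor //= -mulnA mulnCA dvdn_mulr.
  have qA := dvdn_card_class_words csG pr_q _ N_gt0 qN.
  have := qA y; rewrite oy dvdnn => /(_ isT) {}qA.
  have SE := card_class_words csG N Gy.
  set S := \sum_i _ in SE.
  have TS: (T == S %[mod (q ^ a)%N])%A.
    rewrite /T big_mkcond /= /eqAmod -sumrB rpred_sum // => i _.
    have -> : (if B i then 'chi_i 1%g * ('chi_i y)^* else 0)
       = (B i)%:R * ('chi_i 1%g * ('chi_i y)^*).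
      by case: (B i); rewrite ?mul1r ?mul0r.
    rewrite -mulrA -/(eqAmod _ _ _) eqAmod_sym eqAmodMr //.
      by rewrite rpredM ?Aint_irr // Aint_aut Aint_irr.
    exact: (Cint_expn_totient_mod pr_q (ltn0Sn _) (ZW i)).
  have qS: ((q ^ b)%N %| S)%A.
    rewrite -SE -natrM -eqAmod0 eqAmod0_nat dvdn_mull //.
    by apply: dvdn_trans qA; rewrite dvdn_exp2l // /a -addSn addnK.
  have nzq n : (q ^ n)%:R != 0 :> algC by rewrite pnatr_eq0 -lt0n expn_gt0 prime_gt0.
  move: TS qS; rewrite /eqAmod !dvdA_natE ?expn_gt0 ?prime_gt0 // => TS qS.
  have -> : T / (q ^ b)%:R = (T - S) / (q ^ a)%:R * (q ^ (a - b))%:R + S / (q ^ b)%:R.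
    have le_ba: (b <= a)%N by rewrite ltnW // ltnS leq_addr.
    rewrite -{1}(subnKC le_ba) expnD natrM invfM mulrA mulfVK //.
    by rewrite -mulrDl subrK.
  by rewrite rpredD // rpredM ?rpred_nat.
have ZT: T \in Aint by have := dvdT 0; rewrite expn0 divr1.
(* [T] need not be rational, but its norm [P] is a rational integer; dividing a single factor by
   [q ^ b] shows that [q ^ b] divides [P]. *)
pose P := \prod_(j <- r) u j T.
have QP: P \in Crat.
  pose a i := if B i then 'chi[G]_i 1%g else 0.
  have TE: T = \sum_i a i * 'chi_i (y^-1)%g.
    rewrite /T big_mkcond; apply: eq_bigr => i _; rewrite irr_inv /a.
    by case: (B i); rewrite ?mul0r.
  rewrite /P TE; apply: u_rat; rewrite ?groupV // => i; rewrite /a irr1_degree.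
  by case: (B i); rewrite ?rpred0 ?rpred_nat.
have P0: P = 0.
  apply: (Cint_unbounded_dvd (prime_gt1 pr_q)) => [|b].
    by rewrite Cint_rat_Aint // rpred_prod // => j _; rewrite Aint_aut.
  rewrite Cint_rat_Aint ?rpred_div ?rpred_nat // /P.
  case: (r) nz_r => // j r' _; rewrite big_cons mulrAC rpredM //.
    by rewrite -(rmorph_nat (u j)) -fmorph_div Aint_aut.
  by rewrite rpred_prod // => i _; rewrite Aint_aut.
have T0: T = 0.
  move/eqP: P0; rewrite prodf_seq_eq0 => /hasP[j _ /=].
  by rewrite fmorph_eq0 => /eqP.
have nqc: ~~ (q %| #|c ^: G|)%N.
  apply: contra neq_qp => /pnat_dvd/(_ pcG); rewrite pnatE // inE.
(* Here the character value has modulus 1, so [W i] is up to sign a power of the class size. *)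
have linB i : 'chi_i \is a linear_char -> B i.
  move=> lin; have -> : B i = ~~ (q %| \prod_(j <- r) #|c ^: G|)%N.
    rewrite /B; congr (~~ (q %| _)%N); rewrite -[RHS](@natrK algC); congr (Num.truncn _).
    rewrite /W big_map normr_prod natr_prod; apply: eq_bigr => j _.
    rewrite /om card_class_expg // lin_char1 // divr1 normrM normr_nat.
    by rewrite normC_lin_char ?groupX // mulr1.
  elim/big_ind: _ => // [|m n]; first by rewrite Euclid_dvd1.
  by rewrite Euclid_dvdM // negb_or => -> ->.
have pR: (p %| \sum_(i | B i && ('chi[G]_i \isn't a linear_char))
              'chi[G]_i 1%g * ('chi_i y)^*)%A.
  rewrite rpred_sum // => i /andP[Bi nlin].
  have [|npi] := boolP (p %| 'chi_i 1%g)%C.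
    case/dvdCP=> d Zd ->; rewrite mulrAC -eqAmod0 eqAmodMl0 //.
    by rewrite rpredM ?(Aint_Cint Zd) // Aint_aut Aint_irr.
  (* Vanishing on [c] makes the norm [W i] zero, against [B i]. *)
  have chi0 := irr_nonlinear_vanish pr_p genG pcG nlin npi.
  case/negP: Bi; rewrite WE; case: (r) nz_r => // j r' _.
  by rewrite big_cons /om chi0 mulr0 mul0r rmorph0 mul0r normr0 truncn0 dvdn0.
case/negP: p'iG; rewrite -eqAmod0_nat eqAmod0 -card_lin_irr -rpredN.
(* As [y] lies in the derived subgroup, each linear character contributes exactly 1. *)
have TE: T = #|[pred i | 'chi[G]_i \is a linear_char]|%:R +
   \sum_(i | B i && ('chi[G]_i \isn't a linear_char)) 'chi[G]_i 1%g * ('chi_i y)^*.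
  rewrite /T (bigID (fun i => 'chi_i \is a linear_char)) /=; congr (_ + _).
  rewrite -sum1_card natr_sum; apply: eq_big => i.
    rewrite !inE; case: (boolP ('chi_i \is a linear_char)) => [/linB-> //|].
    by rewrite andbF.
  case/andP=> _ lin; rewrite lin_char1 // mul1r.
  have := lin_irr_der1 i; rewrite lin => /esym /subsetP/(_ y Dy).
  by move=> Ky; rewrite cfker1 // lin_char1 // rmorph1.
have -> : - #|[pred i | 'chi[G]_i \is a linear_char]|%:R =
   \sum_(i | B i && ('chi[G]_i \isn't a linear_char)) 'chi[G]_i 1%g * ('chi_i y)^*.
  by apply/eqP; rewrite eq_sym -addr_eq0 addrC -TE T0.
by [].
Qed.

End CharacterTheory.

(** For a Sylow subgroup [P] containing [x], the index of the centralizer gives ['C_G[x] * P = G].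
    So all conjugates of [x] are conjugates under [P], and they generate a normal [p]-subgroup. *)
Lemma p_elt_class_sub_pcore (gT : finGroupType) (G : {group gT}) (p : nat) x :
    prime p -> x \in G -> p.-elt x -> p.-nat #|x ^: G| ->
  x ^: G \subset 'O_p(G).
Proof.
move=> pr_p Gx px pxG.
have sxG: <[x]> \subset G by rewrite cycle_subG.
have [P sylP sxP] := Sylow_superset sxG px.
rewrite cycle_subG in sxP; have [sPG pP _] := and3P sylP.
have defG: 'C_G[x] * P = G.
  apply: coprime_index_mulG; rewrite ?subsetIl // index_cent1.
  by apply: pnat_coprime pxG _; case/and3P: sylP.
have sxGP: x ^: G \subset P.
  apply/subsetP=> _ /imsetP[g Gg ->]; move: Gg; rewrite -defG.
  case/mulsgP=> h k /setIP[_ /cent1P cxh] Pk ->.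
  have -> : x ^ (h * k) = x ^ k by rewrite conjgM (conjgE x h) -cxh mulKg.
  by rewrite groupJ.
apply: subset_trans (subset_gen _) (pcore_max _ _).
  by apply: pgroupS pP; rewrite gen_subG.
by rewrite /normal gen_subG class_subG // norms_gen ?class_norm.
Qed.

Lemma der1_pgroup (gT : finGroupType) (G : {group gT}) (p : nat) c :
    prime p -> <<c ^: G>> = G -> p.-nat #|c ^: G| ->
  p.-group G^`(1).
Proof.
move=> pr_p genG pcG; have Gc: c \in G.
  by have := mem_gen (class_refl G c); rewrite genG.
set N := 'O_p(G); have nNG: G \subset 'N(N) by apply: gFnorm.
have Nc: c \in 'N(N) by apply: subsetP nNG _ Gc.
(* The [p]-part of [c] is a power of [c], so its class size divides that of [c]. *)
have Ncp: c.`_p \in N.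
  apply: (subsetP (p_elt_class_sub_pcore pr_p _ _ _)) (class_refl _ _).
  - by rewrite groupX.
  - exact: p_elt_constt.
  have sC: 'C[c] \subset 'C[c.`_p].
    by rewrite -!cent_cycle centS // cycle_subG groupX ?cycle_id.
  apply: pnat_dvd pcG; rewrite -!index_cent1; apply: indexgS; exact: setIS.
pose cb := coset N c.
have p'cb: p^'.-elt cb.
  rewrite /cb -(consttC p c) morphM ?groupX //= coset_id // mul1g.
  by rewrite morph_p_elt ?groupX // p_elt_constt.
have classb: (c ^: G) / N = cb ^: (G / N) by rewrite /quotient morphim_class.
have genGb: <<cb ^: (G / N)>> = G / N.
  by rewrite -classb -quotient_gen ?genG // class_subG // (subset_trans _ nNG).
have pcGb: p.-nat #|cb ^: (G / N)|.
  apply: pnat_dvd pcG; rewrite -!index_cent1.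
  apply: dvdn_trans (index_morphim (coset_morphism N) _); last first.
    by rewrite subIset // nNG.
  apply: indexgS; rewrite subsetI morphimS ?subsetIl //.
  apply/subsetP=> _ /morphimP[h Nh /setIP[Gh /cent1P chc] ->].
  by apply/cent1P; rewrite /commute /cb -!morphM ?chc.
set Gb := G / N in classb genGb pcGb.
have Gcb: cb \in Gb by rewrite mem_quotient.
(* The abelianization is generated by the image of the [p']-element [cb]. *)
have p'ib: ~~ (p %| #|Gb : Gb^`(1)|).
  have nD: Gb \subset 'N(Gb^`(1)) by apply: der_norm.
  have nDc: <[cb]> \subset 'N(Gb^`(1)) by rewrite cycle_subG (subsetP nD).
  have sG: Gb \subset <[cb]> <*> Gb^`(1).
    have: <<cb ^: Gb>> \subset <[cb]> <*> Gb^`(1); last by rewrite genGb.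
    rewrite gen_subG; apply/subsetP=> _ /imsetP[g Gg ->].
    rewrite conjg_mulR groupM ?mem_gen ?inE ?cycle_id //.
    by rewrite mem_commg ?orbT.
  rewrite -card_quotient // -p'natE //.
  have sq: Gb / Gb^`(1) \subset <[cb]> / Gb^`(1).
    by rewrite (subset_trans (quotientS _ sG)) // quotientYidr.
  apply: pnat_dvd p'cb; rewrite (dvdn_trans (cardSg sq)) //.
  exact: dvdn_quotient.
have := der1_pgroup_p'index pr_p genGb pcGb p'ib.
rewrite -quotient_der // pquotient_pgroup ?pcore_pgroup //.
by rewrite (subset_trans (der_sub 1 G)).
Qed.

(** * p-groups with a fixed-point-free action on the abelianization *)

(* On an abelian [V] the map [v |-> [~ v, c]] is an endomorphism, here
   surjective, hence injective. *)
Lemma abelian_commg_full_cent (gT : finGroupType) (V : {group gT}) (c : gT) :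
    abelian V -> c \in 'N(V) -> [~: V, <[c]>] = V ->
  'C_V[c] = 1.
Proof.
move=> cVV nVc fullV; pose phi v := [~ v, c].
have phiV v : v \in V -> phi v \in V.
  by move=> Vv; rewrite /phi commgEl groupMl ?groupV // memJ_norm.
have phiM : {in V &, {morph phi : u v / u * v}}.
  move=> u v Vu Vv; rewrite /phi commMgJ; congr (_ * _).
  by apply/conjg_fixP/commgP; apply: (centsP cVV); rewrite // -/(phi u) phiV.
have gI : group_set (phi @: V).
  apply/group_setP; split; first by apply/imsetP; exists 1; rewrite // /phi comm1g.
  move=> _ _ /imsetP[u Vu ->] /imsetP[v Vv ->].
  by rewrite -phiM // imset_f // groupM.
pose I := Group gI.
have sIV : I \subset V by apply/subsetP=> _ /imsetP[v Vv ->]; apply: phiV.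
have nIV : V \subset 'N(I).
  by apply: cents_norm; apply: subset_trans cVV (centS sIV).
have nIc : c \in 'N(I).
  rewrite inE; apply/subsetP=> _ /imsetP[_ /imsetP[v Vv ->] ->].
  apply/imsetP; exists (v ^ c); first by rewrite memJ_norm.
  by rewrite /phi conjRg [c ^ c]conjgE mulKg.
(* Modulo the image [I], [c] centralizes [V]. *)
have sVI : V \subset I.
  have: [~: V, <[c]>] \subset I; last by rewrite fullV.
  rewrite -quotient_cents2 ?cycle_subG //.
  rewrite quotient_cycle // cent_cycle.
  apply/subsetP=> _ /morphimP[v Nv Vv ->]; apply/cent1P/commgP.
  rewrite -morphR //= coset_id //.
  by apply/imsetP; exists v.
have injphi : {in V &, injective phi}.
  by apply/imset_injP; rewrite eqn_leq leq_imset_card subset_leq_card.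
apply/trivgP/subsetP=> v /setIP[Vv /cent1P cvc]; rewrite inE; apply/eqP.
apply: injphi => //; by rewrite /phi comm1g; apply/eqP/commgP; exact: commute_sym.
Qed.

Section TwistedP3Group.

Variables (gT : finGroupType) (D : {group gT}) (p : nat) (c : gT).
Hypotheses (pr_p : prime p) (pD : p.-group D) (nDc : c \in 'N(D)).
Hypothesis fullD : [~: D, <[c]>] = D.

(** [[D, c] = D] passes to the abelianization, where [abelian_commg_full_cent] excludes nontrivial
    fixed points. *)
Lemma commg_full_der1 d : d \in D -> [~ d, c] \in D^`(1) -> d \in D^`(1).
Proof.
move=> Dd D'dc.
have nD'D : D \subset 'N(D^`(1)) := der_norm 1 D.
have nD'c : c \in 'N(D^`(1)).
  have /subsetP : 'N(D) \subset 'N(D^`(1)) by apply: char_norms; apply: der_char.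
  exact.
have abV : abelian (D / D^`(1)) by apply: der_abelian.
have nVc : coset D^`(1) c \in 'N(D / D^`(1)).
  have /subsetP : 'N(D) / D^`(1) \subset 'N(D / D^`(1)) by apply: morphim_norm.
  by apply; apply: mem_morphim.
have fullV : [~: D / D^`(1), <[coset D^`(1) c]>] = D / D^`(1).
  by rewrite -quotient_cycle // -quotientR ?cycle_subG ?fullD.
have trivC := abelian_commg_full_cent abV nVc fullV.
have Nd : d \in 'N(D^`(1)) := subsetP nD'D d Dd.
apply: coset_idr => //; apply/set1gP; rewrite -trivC.
rewrite inE mem_quotient //=; apply/cent1P/commgP.
by rewrite -morphR //= coset_id.
Qed.

Lemma commg_full_cent_der1 : 'C_D[c] \subset D^`(1).
Proof.
apply/subsetP=> d /setIP[Dd /cent1P cdc]; apply: commg_full_der1 => //.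
by have /commgP/eqP-> : commute d c by [].
Qed.

Hypotheses (le_p3D : p ^ 3 <= #|D|) (oZ : #|'Z(D)| = p).
Hypothesis le_iC : #|D : 'C_D[c]| <= p ^ 2.

Lemma twisted_not_abelian : ~~ abelian D.
Proof.
apply/negP=> /center_idP defZ; move: le_p3D; rewrite -defZ oZ leqNgt.
by rewrite -[X in X < _]expn1 ltn_exp2l ?prime_gt1.
Qed.

(** Otherwise the abelianization is cyclic, and a nilpotent group with cyclic abelianization is
    cyclic. *)
Lemma twisted_card_der1_quo : p ^ 2 <= #|D : D^`(1)|.
Proof.
have nD'D : D \subset 'N(D^`(1)) := der_norm 1 D.
rewrite leqNgt; apply/negP=> lt_i.
have cycD : cyclic (D / D^`(1)).
  have pV : p.-group (D / D^`(1)) by apply: quotient_pgroup.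
  move: lt_i; rewrite -card_quotient //.
  have [k oV] := p_natP pV.
  rewrite oV ltn_exp2l ?prime_gt1 //; case: k oV => [|[|//]] oV _.
    by move/eqP: oV; rewrite expn0 -trivg_card1 => /eqP->; apply: cyclic1.
  by apply: prime_cyclic; rewrite oV expn1.
case/negP: twisted_not_abelian; apply: cyclic_abelian.
exact: cyclic_nilpotent_quo_der1_cyclic (pgroup_nil pD) cycD.
Qed.

Lemma twisted_cent_der1 : 'C_D[c] = D^`(1).
Proof.
apply/eqP; rewrite eqEcard commg_full_cent_der1.
have := leq_trans le_iC twisted_card_der1_quo.
rewrite -(leq_pmul2l (cardG_gt0 'C_D[c])) Lagrange ?subsetIl //.
by rewrite -(Lagrange (der_sub 1 D)) leq_pmul2r.
Qed.

(** [[D', c] = 1] and the three subgroups lemma give [[[c, D], D'] = 1], that is [[D, D'] = 1].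
    Equality follows since [D'] is nontrivial and the center has order [p]. *)
Lemma twisted_center : 'Z(D) = D^`(1).
Proof.
have cD'c : [~: D^`(1), <[c]>] = 1.
  apply/commG1P; rewrite -twisted_cent_der1 cent_cycle; exact: subsetIr.
have sD'Z : D^`(1) \subset 'Z(D).
  rewrite subsetI der_sub; apply/commG1P.
  have h1 : [~: D, D^`(1), <[c]>] = 1.
    have: [~: D, D^`(1), <[c]>] \subset [~: D^`(1), <[c]>].
      by rewrite commSg // commg_subr der_norm.
    by rewrite cD'c => /trivgP.
  have h2 : [~: D^`(1), <[c]>, D] = 1 by rewrite cD'c comm1G.
  have := three_subgroup h1 h2.
  by rewrite [[~: <[c]>, D]]commGC fullD commGC.
apply/eqP; rewrite eq_sym eqEcard sD'Z oZ /=.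
have [k oD'] := p_natP (pgroupS (der_sub 1 D) pD).
rewrite oD' -[X in X <= _]expn1 leq_exp2l ?prime_gt1 // lt0n.
apply: contra twisted_not_abelian => /eqP k0.
by apply/derG1P/eqP; rewrite trivg_card1 oD' k0.
Qed.

Lemma twisted_card : #|D| = (p ^ 3)%N.
Proof.
rewrite -(Lagrange (center_sub D)) oZ expnS; congr (_ * _)%N; apply/eqP.
have eC : #|D : 'Z(D)| = #|D : 'C_D[c]|.
  by rewrite twisted_center twisted_cent_der1.
have eD : #|D : 'Z(D)| = #|D : D^`(1)| by rewrite twisted_center.
by rewrite eqn_leq {1}eC le_iC eD twisted_card_der1_quo.
Qed.

(** The generators [[d, a]], with [a] in [<[c]>], are killed by [p]: up to a trivial correction, the
    [p]-th power is [d ^- p * (d ^+ p) ^ a], and [c] fixes the central [d ^+ p]. Class 2 with [p]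
    odd extends this to all of [D]. *)
Lemma twisted_exponent : odd p -> exponent D %| p.
Proof.
move=> odd_p; have defD : 'Ohm_1(D) = D.
  apply/eqP; rewrite eqEsubset Ohm_sub /= (OhmE 1 pD) -{1}fullD genS //.
  apply/subsetP=> _ /imset2P[d a Dd ca ->].
  have Dda : [~ d, a] \in D.
    by rewrite -fullD mem_commg.
  rewrite !inE Dda expn1 /=.
  have der_p x : x \in D^`(1) -> x ^+ p = 1.
    by move=> D'x; apply/eqP; rewrite -order_dvdn -oZ twisted_center order_dvdG.
  have cD' x y : x \in D -> y \in D^`(1) -> commute x y.
    rewrite -twisted_center => Dx /setIP[_ /centP cDy]; exact/commute_sym/cDy.
  have Da : d ^ a \in D.
    by rewrite memJ_norm //; apply: subsetP ca; rewrite cycle_subG.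
  have Dv : d^-1 \in D by rewrite groupV.
  have D'R : [~ d ^ a, d^-1] \in D^`(1) by apply: mem_commg.
  rewrite commgEl expMg_Rmul; try exact: cD'.
  (* For odd [p] the binomial exponent is a multiple of [p]. *)
  rewrite (_ : _ ^+ 'C(p, 2) = 1) ?mulg1; last first.
    by rewrite bin2odd // expgM der_p // expg1n.
  have Zdp : d ^+ p \in D^`(1).
    rewrite -twisted_center inE groupX //; apply/centP=> e De; apply/commgP.
    rewrite commXg; first by rewrite der_p // mem_commg.
    by apply: cD' => //; apply: mem_commg.
  have cap : d ^+ p ^ a = d ^+ p.
    apply/conjg_fixP/commgP; move: Zdp; rewrite -twisted_cent_der1.
    by rewrite -cent_cycle => /setIP[_ /centP]; apply.
  by rewrite -conjXg cap expVgn mulVg.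
rewrite -defD; apply: exponent_Ohm1_class2 => //.
by rewrite nil_class2 twisted_center.
Qed.

End TwistedP3Group.

(** * Displacement groups of connected quandles *)

Section ConnectedQuandle.

Variable Q : finQuandle.

Lemma qLE (a b : Q) : qL a b = qop a b.
Proof. by rewrite permE. Qed.

Lemma qL_in_LMlt (a : Q) : qL a \in LMlt Q.
Proof. by rewrite mem_gen // imset_f. Qed.

(** The automorphisms of [Q] form a group, which contains the left multiplications by
    distributivity. *)
Lemma LMlt_qop (g : {perm Q}) a b :
  g \in LMlt Q -> g (qop a b) = qop (g a) (g b).
Proof.
pose A := [set s : {perm Q} |
  [forall x, forall y, s (qop x y) == qop (s x) (s y)]].
have AP (s : {perm Q}) : reflect (forall x y, s (qop x y) = qop (s x) (s y)) (s \in A).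
  rewrite inE; apply: (iffP forallP) => [h x y | h x].
    exact/eqP/(forallP (h x)).
  by apply/forallP=> y; apply/eqP.
have gA : group_set A.
  apply/group_setP; split; first by apply/AP=> x y; rewrite !perm1.
  by move=> s t /AP hs /AP ht; apply/AP=> x y; rewrite !permM hs ht.
have : LMlt Q \subset Group gA.
  rewrite gen_subG; apply/subsetP=> _ /imsetP[x _ ->].
  by apply/AP=> y z; rewrite !qLE qop_distl.
by move/subsetP=> sLA Lg; apply/AP/sLA.
Qed.

Lemma qL_conjg (g : {perm Q}) a : g \in LMlt Q -> qL a ^ g = qL (g a).
Proof.
move=> Lg; apply/permP=> x.
by rewrite conjgE !permM !qLE LMlt_qop // permKV.
Qed.

Lemma Dis_sub_LMlt : Dis Q \subset LMlt Q.
Proof.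
rewrite gen_subG; apply/subsetP=> _ /imset2P[a b _ _ ->].
by rewrite groupM ?groupV ?qL_in_LMlt.
Qed.

Lemma LMlt_norm_Dis : LMlt Q \subset 'N(Dis Q).
Proof.
apply: norms_gen; apply/subsetP=> g Lg; rewrite inE.
apply/subsetP=> _ /imsetP[_ /imset2P[a b _ _ ->] ->].
by rewrite conjMg conjVg !qL_conjg //; apply/imset2P; exists (g a) (g b).
Qed.

Hypothesis connQ : qconnected Q.
Variable e : Q.
Local Notation c := (qL e).
Local Notation D := (Dis Q).
Local Notation L := (LMlt Q).

Lemma qL_base_fix : c e = e.
Proof. by rewrite qLE qop_idem. Qed.

Lemma orbit_LMlt (x : Q) : exists2 g, g \in L & x = g e.
Proof.
have := atransP connQ e (in_setT e) => /setP/(_ x).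
by rewrite in_setT => /orbitP[g Lg <-]; exists g.
Qed.

(** [LMlt Q] is contained in [<[c]> * D], and [c] fixes [e]. *)
Lemma orbit_Dis (x : Q) : exists2 d, d \in D & x = d e.
Proof.
have [g Lg ->] := orbit_LMlt x.
have nDc : <[c]> \subset 'N(D).
  by rewrite cycle_subG (subsetP LMlt_norm_Dis) ?qL_in_LMlt.
have sLcD : L \subset <[c]> * D.
  rewrite -norm_joinEl // gen_subG; apply/subsetP=> _ /imsetP[a _ ->].
  have -> : qL a = c * (c^-1 * qL a) by rewrite mulKVg.
  rewrite groupM ?mem_gen // inE ?cycle_id //.
  apply/orP; right; apply: mem_gen; by apply/imset2P; exists a e.
have /mulsgP[_ d /cycleP[i ->] Dd ->] := subsetP sLcD g Lg.
exists d => //; rewrite permM permX; congr (d _).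
by elim: i => //= i ->; rewrite qL_base_fix.
Qed.

Lemma class_qL : c ^: L = [set qL a | a : Q].
Proof.
apply/setP=> s; apply/imsetP/imsetP=> [[g Lg ->] | [a _ ->]].
  by exists (g e); rewrite ?qL_conjg.
by have [g Lg ->] := orbit_LMlt a; exists g; rewrite ?qL_conjg.
Qed.

Lemma gen_class_qL : <<c ^: L>> = L.
Proof. by rewrite class_qL. Qed.

(** By [qL_conjg] the stabilizer of [e] centralizes [c]. *)
Lemma card_class_qL_dvd : #|c ^: L| %| #|Q|.
Proof.
have -> : #|Q| = #|orbit 'P L e| by rewrite (atransP connQ) ?cardsT.
rewrite -index_cent1 card_orbit; apply: indexgS.
apply/subsetP=> g /setIP[Lg /astab1P /= ge]; apply/setIP; split=> //.
apply/cent1P/commute_sym/commgP/conjg_fixP.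
by rewrite qL_conjg // -[X in _ = qL X]ge.
Qed.

(** If [x = d e] then [c^-1 * qL x = [~ c, d]]; the generators of [D] are quotients of such
    elements. *)
Lemma Dis_commg : [~: D, <[c]>] = D.
Proof.
have Lc := qL_in_LMlt e.
apply/eqP; rewrite eqEsubset commg_subl cycle_subG (subsetP LMlt_norm_Dis) //=.
rewrite gen_subG; apply/subsetP=> _ /imset2P[a b _ _ ->].
have R x : c^-1 * qL x \in [~: D, <[c]>].
  have [d Dd ->] := orbit_Dis x.
  rewrite -qL_conjg ?(subsetP Dis_sub_LMlt) // -commgEl.
  by rewrite commGC mem_commg ?cycle_id.
have -> : (qL b)^-1 * qL a = (c^-1 * qL b)^-1 * (c^-1 * qL a).
  by rewrite invMg invgK -mulgA mulKVg.
by rewrite groupM ?groupV.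
Qed.

(** [D = [D, c]] lies in the derived subgroup of [LMlt Q], which is generated by the class of
    [c]. *)
Lemma Dis_pgroup (p n : nat) : prime p -> #|Q| = (p ^ n)%N -> p.-group D.
Proof.
move=> pr_p oQ; have pcL : p.-nat #|c ^: L|.
  by apply: pnat_dvd card_class_qL_dvd _; rewrite oQ pnatX pnat_id.
apply: pgroupS (der1_pgroup pr_p gen_class_qL pcL).
by rewrite -Dis_commg commgSS ?Dis_sub_LMlt // cycle_subG qL_in_LMlt.
Qed.

Lemma card_class_qL_nonfaithful (p n : nat) :
    prime p -> #|Q| = (p ^ n.+1)%N -> ~ qfaithful Q ->
  #|D : 'C_D[c]| <= p ^ n.
Proof.
move=> pr_p oQ nfQ; rewrite index_cent1.
have sDL : c ^: D \subset c ^: L by apply: imsetS; apply: Dis_sub_LMlt.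
apply: leq_trans (subset_leq_card sDL) _.
have := card_class_qL_dvd; rewrite oQ => /(dvdn_pfactor _ _ pr_p)[k le_k oC].
rewrite oC leq_exp2l ?prime_gt1 //; move: le_k; rewrite leq_eqVlt => /predU1P[kE|//].
case: nfQ; rewrite /qfaithful; suff: {in [set: Q] &, injective (@qL Q)}.
  by move=> inj a b; apply: inj; rewrite inE.
apply/imset_injP; rewrite cardsT oQ -kE -oC class_qL; apply/eqP.
by apply: eq_card => s; apply/imsetP/imsetP=> [] [x _ ->]; exists x; rewrite ?inE.
Qed.

Lemma card_Dis_base : #|D| = (#|Q| * #|'C_D[e | 'P]|)%N.
Proof.
rewrite -(card_orbit_stab 'P D e); congr (_ * _)%N; rewrite -cardsT.
apply: eq_card => x; rewrite inE; have [d Dd ->] := orbit_Dis x.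
by rewrite -apermE mem_orbit.
Qed.

End ConnectedQuandle.

(** * The semidirect product as an extraspecial group *)

Lemma nonabelian_Zp2_sdprod_Zp_extraspecial (p : nat) (G : finGroupType) :
    prime p -> nonabelian_Zp2_sdprod_Zp p G -> extraspecial [set: G].
Proof.
move=> pr_p [oG nabG _]; apply: (@p3group_extraspecial p) => //.
  by rewrite /pgroup cardsT oG pnatX pnat_id.
by rewrite cardsT oG pfactorK.
Qed.

(** [G] has class 2 and is generated by elements killed by the odd prime [p], so it has exponent
    [p]; this determines an extraspecial group of order [p ^ 3]. *)
Lemma nonabelian_Zp2_sdprod_Zp_isog (p : nat) (G : finGroupType) :
    prime p -> odd p -> nonabelian_Zp2_sdprod_Zp p G ->
  [set: G] \isog [set: p^{1+2}].
Proof.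
move=> pr_p odd_p hG; have esG := nonabelian_Zp2_sdprod_Zp_extraspecial pr_p hG.
case: hG => oG _ [K [H [isoK isoH defG]]].
have pG : p.-group [set: G] by rewrite /pgroup cardsT oG pnatX pnat_id.
apply: isog_pX1p2; rewrite ?cardsT //.
have p_gt1 := prime_gt1 pr_p.
have Zp0 (x : 'Z_p) : x ^+ p = 1.
  have oZp : #|[set: 'Z_p]| = p by rewrite cardsT card_ord Zp_cast.
  by have := expg_cardG (in_setT x); rewrite oZp.
have elK : forall x, x \in K -> x ^+ p = 1.
  have /isogP[g injg gK] := isoK => x Kx; apply: (injmP injg); rewrite ?groupX //.
  rewrite morphX // morph1.
  have expE (a b : 'Z_p) n : (a, b) ^+ n = (a ^+ n, b ^+ n).
    by elim: n => [|n IHn] //; rewrite !expgS IHn.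
  by case: (g x) => a b; rewrite expE !Zp0.
have elH : forall x, x \in H -> x ^+ p = 1.
  have /isogP[g injg gH] := isoH => x Hx; apply: (injmP injg); rewrite ?groupX //.
  by rewrite morphX // morph1 Zp0.
have defO : 'Ohm_1([set: G]) = [set: G].
  apply/eqP; rewrite eqEsubset Ohm_sub /= (OhmE 1 pG).
  have: K <*> H \subset <<'Ldiv_(p ^ 1)([set: G])>>; last by rewrite (sdprodWY defG).
  rewrite join_subG; apply/andP; split; apply/subsetP=> x Ax.
    by rewrite mem_gen // !inE expn1 elK // eqxx.
  by rewrite mem_gen // !inE expn1 elH // eqxx.
have cl2 : nil_class [set: G] <= 2 by rewrite nil_class2; case: esG => [[_ ->] _].
by have := exponent_Ohm1_class2 odd_p pG cl2; rewrite defO.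
Qed.

(** * Transport of a regular displacement group *)

Section RegularDis.

Variables (Q : finQuandle) (e : Q) (G : finGroupType).
Local Notation c := (qL e).
Local Notation D := (Dis Q).
Hypotheses (connQ : qconnected Q) (oD : #|D| = #|Q|).
Variable g : {morphism D >-> G}.
Hypotheses (injg : 'injm g) (imgD : g @* D = [set: G]).

Lemma Dis_regular d d' : d \in D -> d' \in D -> d e = d' e -> d = d'.
Proof.
have injD : {in D &, injective (fun s : {perm Q} => s e)}.
  apply/imset_injP; rewrite oD -cardsT; apply/eqP; apply: eq_card => x.
  rewrite inE; have [s Ds ->] := orbit_Dis connQ e x.
  by apply/imsetP; exists s.
exact: injD.
Qed.

Definition Dis_of (x : Q) : {perm Q} := odflt 1 [pick d in D | d e == x].

Lemma Dis_ofP x : Dis_of x \in D /\ Dis_of x e = x.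
Proof.
rewrite /Dis_of; case: pickP => [d /andP[Dd /eqP dx] // | nod].
by have [d Dd xE] := orbit_Dis connQ e x; have := nod d; rewrite /= Dd xE eqxx.
Qed.

Lemma Dis_ofE d : d \in D -> Dis_of (d e) = d.
Proof. by move=> Dd; have [? ?] := Dis_ofP (d e); apply: Dis_regular. Qed.

Lemma conjg_base_Dis d : d \in D -> d ^ c \in D.
Proof.
by move=> Dd; rewrite memJ_norm // (subsetP (LMlt_norm_Dis Q)) ?qL_in_LMlt.
Qed.

Lemma preim_Dis y : exists2 d, d \in D & y = g d.
Proof.
have : y \in g @* D by rewrite imgD inE.
by case/morphimP=> d _ Dd ->; exists d.
Qed.

(** Conjugation by [c], carried from [D] to [G] along [g]. *)
Definition transport_fun (y : G) : G :=
  g ((odflt 1 [pick d in D | g d == y]) ^ c).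

Lemma transport_funE d : d \in D -> transport_fun (g d) = g (d ^ c).
Proof.
move=> Dd; rewrite /transport_fun; case: pickP => [d' /andP[Dd' /eqP gd] | nod].
  by rewrite (injmP injg d' d Dd' Dd gd).
by have := nod d; rewrite /= Dd eqxx.
Qed.

Lemma transport_fun_inj : injective transport_fun.
Proof.
move=> y z; have [d Dd ->] := preim_Dis y; have [d' Dd' ->] := preim_Dis z.
rewrite !transport_funE // => /(injmP injg); rewrite !conjg_base_Dis // => eqd.
by rewrite (conjg_inj _ (eqd isT isT)).
Qed.

Definition transport_aut : {perm G} := perm transport_fun_inj.

Lemma transport_autE d : d \in D -> transport_aut (g d) = g (d ^ c).
Proof. by move=> Dd; rewrite permE transport_funE. Qed.

Lemma transport_aut_Aut : transport_aut \in Aut [set: G].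
Proof.
rewrite inE; apply/andP; split; first by apply/subsetP=> y; rewrite inE.
apply/morphicP=> y z _ _.
have [d Dd ->] := preim_Dis y; have [d' Dd' ->] := preim_Dis z.
by rewrite -morphM // !transport_autE ?groupM // conjMg morphM ?conjg_base_Dis.
Qed.

(* [(s * t) x = t (s x)], so [d |-> d e] turns left translations into right
   ones; hence the inverse. *)
Definition quandle_to_group (x : Q) : G := g (Dis_of x)^-1.

Lemma quandle_to_group_bij : #|G| = #|Q| -> bijective quandle_to_group.
Proof.
move=> oG; apply: inj_card_bij; last by rewrite oG.
move=> x y; rewrite /quandle_to_group.
have [Dx xE] := Dis_ofP x; have [Dy yE] := Dis_ofP y.
by move/(injmP injg); rewrite !groupV => /(_ Dx Dy)/invg_inj eqxy; rewrite -xE eqxy.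
Qed.

Lemma quandle_to_group_qop a b :
  quandle_to_group (qop a b)
    = qhom_op transport_aut (quandle_to_group a) (quandle_to_group b).
Proof.
rewrite /quandle_to_group /qhom_op.
have [Da aE] := Dis_ofP a; have [Db bE] := Dis_ofP b.
set da := Dis_of a in Da aE *; set db := Dis_of b in Db bE *.
(* [k] is the displacement sending [e] to [qop a b]: [qL a] is the conjugate of [c] by [da], and
   [c^-1] fixes [e]. *)
pose k := (db * da^-1) ^ c * da.
have Dk : k \in D by rewrite groupM ?conjg_base_Dis ?groupM ?groupV.
have cVe : (c^-1)%g e = e by apply: (@perm_inj _ c); rewrite permKV qL_base_fix.
have -> : qop a b = k e.
  rewrite -qLE -{1}aE -qL_conjg ?(subsetP (Dis_sub_LMlt Q)) // -bE.
  by rewrite /k !conjgE !permM cVe.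
rewrite Dis_ofE // -morphV ?groupV // -morphM ?groupV // invgK.
rewrite transport_autE ?groupM ?groupV //.
rewrite -morphM ?groupV ?conjg_base_Dis ?groupM ?groupV //.
by rewrite /k invMg -conjVg invMg invgK.
Qed.

Lemma Fix_transport_aut : Fix transport_aut = g @* 'C_D[c].
Proof.
apply/setP=> y; have [d Dd ->] := preim_Dis y.
rewrite inE transport_autE //; apply/eqP/morphimP => [gd | [d' _ /setIP[Dd' cd'] gd]].
  have dc := injmP injg _ _ (conjg_base_Dis Dd) Dd gd.
  exists d; rewrite // inE Dd; apply/cent1P/commgP.
  by apply/conjg_fixP.
rewrite gd in Dd *; congr (g _); rewrite (injmP injg d d') //.
by apply/conjg_fixP/commgP/cent1P.
Qed.

Lemma Fix_der1_transport_aut :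
    (forall d, d \in D -> [~ d, c] \in D^`(1) -> d \in D^`(1)) ->
  Fix_der1 transport_aut = 1.
Proof.
move=> fullD; apply/setP=> x; rewrite !inE.
have NT (y : G) : y \in 'N([set: G]^`(1)).
  by apply: (subsetP (der_norm 1 [set: G])); rewrite inE.
have [y _ ->] := @cosetP _ [set: G]^`(1) x.
have [d Dd ->] := preim_Dis y.
have imgD' : g @* D^`(1) = [set: G]^`(1) by rewrite morphim_der // imgD.
rewrite (induced_der1E transport_aut_Aut) transport_autE //.
apply/eqP/eqP=> [eqc | cd1].
  apply: coset_id; rewrite -imgD' mem_morphim //; apply: fullD => //.
  have Ddc : [~ d, c] \in D by rewrite commgEl groupM ?groupV ?conjg_base_Dis.
  have : g [~ d, c] \in g @* D^`(1).
    rewrite imgD'; apply: coset_idr => //.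
    rewrite commgEl morphM ?groupV ?conjg_base_Dis // morphV //.
    by rewrite morphM //= morphV //= eqc mulVg.
  case/morphimP=> d' Dd' D'd' eqg.
  by rewrite (injmP injg _ _ Ddc Dd' eqg).
have D'd : d \in D^`(1).
  have : g d \in [set: G]^`(1) by apply: coset_idr.
  rewrite -imgD' => /morphimP[d' Dd' D'd' eqg].
  by rewrite (injmP injg _ _ Dd Dd' eqg).
have D'dc : d ^ c \in D^`(1).
  rewrite memJ_norm //.
  have : 'N(D) \subset 'N(D^`(1)) by apply: char_norms; apply: der_char.
  by move/subsetP; apply; apply: (subsetP (LMlt_norm_Dis Q)); apply: qL_in_LMlt.
have : g (d ^ c) \in [set: G]^`(1) by rewrite -imgD' mem_morphim ?conjg_base_Dis.
by move/coset_id; rewrite cd1.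
Qed.

End RegularDis.

Lemma conn_nonfaithful_QHom (p : nat) (p_prime : prime p) (p_gt2 : (2 < p)%N)
    (G : finGroupType) (hG : nonabelian_Zp2_sdprod_Zp p G)
    (Q : finQuandle) (hQ : #|Q| = (p ^ 3)%N) :
    [/\ qconnected Q, ~ qfaithful Q & #|'Z(Dis Q)| = p] ->
  exists (f : {perm G}) (Af : f \in Aut [set: G]),
    [/\ quandle_isom Q (QHom Af), Fix f = 'Z([set: G]) & Fix_der1 f = 1].
Proof.
case=> connQ nfQ oZ; have odd_p : odd p by case/even_prime: (p_prime) p_gt2 => [->|].
have /card_gt0P[e _] : 0 < #|Q| by rewrite hQ expn_gt0 prime_gt0.
have pD := Dis_pgroup connQ e p_prime hQ.
have nDc : qL e \in 'N(Dis Q) by rewrite (subsetP (LMlt_norm_Dis Q)) ?qL_in_LMlt.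
have fullD := Dis_commg connQ e.
have le_iC := card_class_qL_nonfaithful connQ e p_prime hQ nfQ.
have le_D : p ^ 3 <= #|Dis Q|.
  by rewrite (card_Dis_base connQ e) hQ leq_pmulr // cardG_gt0.
have oD : #|Dis Q| = (p ^ 3)%N.
  exact: (twisted_card p_prime pD nDc fullD le_D oZ le_iC).
(* [D] and [G] are identified through the common model of exponent [p]. *)
have isoD : Dis Q \isog [set: p^{1+2}].
  apply: isog_pX1p2 => //; first exact: (card_p3group_extraspecial p_prime oD oZ).
  exact: (twisted_exponent p_prime pD nDc fullD le_D oZ le_iC odd_p).
have isoG := nonabelian_Zp2_sdprod_Zp_isog p_prime odd_p hG.
have /isogP[g injg imgD] : Dis Q \isog [set: G].
  by apply: isog_trans isoD _; rewrite isog_sym.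
have oDQ : #|Dis Q| = #|Q| by rewrite oD hQ.
have oGQ : #|G| = #|Q| by case: hG => -> _ _; rewrite hQ.
exists (transport_aut e injg imgD), (transport_aut_Aut e injg imgD); split.
- exists (quandle_to_group e g); first exact: quandle_to_group_bij.
  exact: quandle_to_group_qop.
(* [C_D(c) = D' = Z(D)], and [g] carries centers to centers. *)
- rewrite Fix_transport_aut (twisted_cent_der1 p_prime pD nDc fullD le_D oZ le_iC).
  by rewrite -(twisted_center p_prime pD nDc fullD le_D oZ le_iC) injm_center // imgD.
apply: Fix_der1_transport_aut => d; exact: (commg_full_der1 nDc fullD).
Qed.

(** * Principal quandles *)

(** Modulo [G'] the map [x |-> x * (f x)^-1] is injective, hence onto. So its values generate [G]
    modulo [G'], which lies in the Frattini subgroup. *)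
Lemma gen_mul_aut_inv (p : nat) (G : finGroupType) (f : {perm G}) :
    f \in Aut [set: G] -> p.-group [set: G] -> Fix_der1 f = 1 ->
  <<[set x * (f x)^-1 | x : G]>> = [set: G].
Proof.
move=> Af pG fix1; set X := [set _ | _ in _].
have NT (y : G) : y \in 'N([set: G]^`(1)).
  by apply: (subsetP (der_norm 1 [set: G])); rewrite inE.
pose pi := coset [set: G]^`(1).
have piM y z : pi (y * z) = pi y * pi z by rewrite /pi morphM.
have piV y : pi y^-1 = (pi y)^-1 by rewrite /pi morphV.
pose psi x := x * (induced_der1 f x)^-1.
have piE x : exists2 y, x = pi y & induced_der1 f x = pi (f y).
  by have [y _ ->] := cosetP x; exists y => //; rewrite induced_der1E.
have psi_inj : injective psi.
  move=> x1 x2; have [y1 -> f1] := piE x1; have [y2 -> f2] := piE x2.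
  rewrite /psi !induced_der1E // => eq12.
  have : pi (y2^-1 * y1) \in Fix_der1 f.
    rewrite inE induced_der1E // (AutT_morph Af) (AutT_morphV Af) -!/(pi _).
    rewrite !piM !piV eq_sym; apply/eqP.
    apply: (@mulgI _ (pi y2)); rewrite mulKVg mulgA.
    by apply: (@mulIg _ (pi (f y1))^-1); rewrite eq12 mulgK.
  rewrite fix1 => /set1gP; rewrite piM piV => /eqP.
  rewrite -eq_mulVg1 => /eqP; exact: esym.
apply: Phi_nongen; apply/eqP; rewrite eqEsubset subsetT /=.
apply/subsetP=> y _; have [psi' _ psiK] := injF_bij psi_inj.
have [x xE] : exists x, pi y = pi (x * (f x)^-1).
  have [x xE fE] := piE (psi' (pi y)); exists x.
  by rewrite piM piV -{1}(psiK (pi y)) /psi fE xE.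
have : pi (y * (x * (f x)^-1)^-1) = 1 by rewrite piM piV xE mulgV.
move/(coset_idr (NT _)) => D1.
rewrite -(mulgKV (x * (f x)^-1) y) groupM ?mem_gen // inE.
  by rewrite (Phi_joing pG) (subsetP (joing_subl _ _)).
by apply/orP; right; apply/imsetP; exists x.
Qed.

Section QuandleOfGroup.

Variables (p : nat) (G : finGroupType) (f : {perm G}) (Q : finQuandle).
Hypotheses (Af : f \in Aut [set: G]) (pG : p.-group [set: G]).
Hypothesis fix1 : Fix_der1 f = 1.
Variables (h : Q -> G) (h' : G -> Q).
Hypotheses (hK : cancel h h') (h'K : cancel h' h).
Hypothesis hM : forall a b, h (qop a b) = qhom_op f (h a) (h b).

Lemma pullback_trans_inj (g : G) : injective (fun x => h' (g^-1 * h x)).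
Proof. by move=> x y /(can_inj h'K)/mulgI/(can_inj hK). Qed.

(** Left translation by the inverse of [g], which gives a morphism under left-to-right
    composition. *)
Definition pullback_trans (g : G) : {perm Q} := perm (@pullback_trans_inj g).

Lemma pullback_transM : {in [set: G] &, {morph pullback_trans : g k / g * k}}.
Proof.
by move=> g k _ _; apply/permP=> x; rewrite permM !permE h'K invMg mulgA.
Qed.
Canonical pullback_trans_morphism := Morphism pullback_transM.

Lemma injm_pullback_trans : 'injm pullback_trans.
Proof.
apply/injmP=> g k _ _ /permP/(_ (h' 1)); rewrite !permE h'K !mulg1.
by move/(can_inj h'K)/invg_inj.
Qed.

(** In the group, left multiplication by [a] is [x |-> a * (f a)^-1 * f x]; the [f x] cancels in the
    quotient of two of them. *)
Lemma qL_quotE a b :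
  (qL b)^-1 * qL a = pullback_trans ((h b * (f (h b))^-1) * (h a * (f (h a))^-1)^-1).
Proof.
apply: (canLR (mulKg _)); apply/permP=> x; rewrite permM !permE.
apply: (can_inj hK); rewrite h'K !hM /qhom_op !(AutT_morph Af) !(AutT_morphV Af).
by rewrite !invMg !invgK !mulgA mulgKV mulgK.
Qed.

Lemma Dis_pullback : Dis Q = pullback_trans @* [set: G] :> {set _}.
Proof.
have f1 : f 1 = 1 by rewrite -(autmE Af) morph1.
apply/eqP; rewrite eqEsubset gen_subG; apply/andP; split.
  apply/subsetP=> _ /imset2P[a b _ _ ->].
  by rewrite qL_quotE mem_morphim ?inE.
have: pullback_trans @* <<[set x * (f x)^-1 | x : G]>> \subset Dis Q; last first.
  by rewrite (gen_mul_aut_inv Af pG fix1).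
rewrite morphim_gen ?subsetT // gen_subG.
apply/subsetP=> _ /morphimP[_ _ /imsetP[y _ ->] ->].
(* Comparing with the base point [h' 1] yields the translation attached to [y * (f y)^-1]. *)
apply: mem_gen; apply/imset2P; exists (h' 1) (h' y); rewrite ?inE //.
by rewrite qL_quotE !h'K f1 invg1 mulg1 invg1 mulg1.
Qed.

Lemma connected_pullback : qconnected Q.
Proof.
apply/imsetP; exists (h' 1); rewrite ?inE //; apply/setP=> x; rewrite inE; symmetry.
apply/orbitP; exists (pullback_trans (h x)^-1).
  apply: (subsetP (Dis_sub_LMlt Q)); rewrite Dis_pullback.
  by rewrite mem_morphim ?inE.
by rewrite /= apermE permE h'K invgK mulg1 hK.
Qed.

(** As [z * (f z)^-1 = 1], the points [h' z] and [h' 1] have the same left multiplication. *)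
Lemma nonfaithful_pullback z : z \in Fix f -> z != 1 -> ~ qfaithful Q.
Proof.
rewrite inE => /eqP fz nz inj; case/eqP: nz.
apply: (can_inj h'K); apply: inj.
have f1 : f 1 = 1 by rewrite -(autmE Af) morph1.
by apply/eqP; rewrite eq_mulVg1 qL_quotE !h'K fz f1 !mulgV morph1.
Qed.

Lemma card_center_pullback : #|'Z(Dis Q)| = #|'Z([set: G])|.
Proof.
by rewrite Dis_pullback -injm_center ?injm_pullback_trans // card_injm
   ?injm_pullback_trans ?subsetT.
Qed.

End QuandleOfGroup.

Theorem theorem5p5 (p : nat) (p_prime : prime p) (p_gt2 : (2 < p)%N)
    (G : finGroupType) (hG : nonabelian_Zp2_sdprod_Zp p G)
    (Q : finQuandle) (hQ : #|Q| = (p ^ 3)%N) :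
  [/\ qconnected Q, ~ qfaithful Q & #|'Z(Dis Q)| = p]
  <->
  exists (f : {perm G}) (Af : f \in Aut [set: G]),
    [/\ quandle_isom Q (QHom Af), Fix f = 'Z([set: G]) & Fix_der1 f = 1].
Proof.
split; first exact: conn_nonfaithful_QHom.
case=> f [Af [[h [h' hK h'K] hM] fixZ fix1]].
have pG : p.-group [set: G].
  by case: hG => oG _ _; rewrite /pgroup cardsT oG pnatX pnat_id.
have esG := nonabelian_Zp2_sdprod_Zp_extraspecial p_prime hG.
have oZ := card_center_extraspecial pG esG.
split.
- exact: (connected_pullback Af pG fix1 hK h'K hM).
- have /trivgPn[z Zz nz] : 'Z([set: G]) != 1.
    by rewrite trivg_card1 oZ neq_ltn prime_gt1 ?orbT.
  by apply: (nonfaithful_pullback Af hK h'K hM (z := z)); rewrite ?fixZ.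
by rewrite (card_center_pullback Af pG fix1 hK h'K hM).
Qed.
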